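(* Let $Y=L^2(0,1)$, let $\tilde A:L^2(0,1)\to L^2(0,1)$ be the integration operator $(\tilde A\tilde x)(s)=\int_0^s\tilde x(t)\,\mathrm{d}t$, let $L:\ell^2(\mathbb{N})\to L^2(0,1)$ be the synthesis operator of the Haar system, and let $A:=\tilde AL$, regarded as a bounded linear operator $\ell^1(\mathbb{N})\to Y$. Then $e^{(1)}=(1,0,0,\ldots)$ does not belong to the range of the adjoint $A^*:Y^*\to\ell^\infty(\mathbb{N})$. Thus it is not true that for every $k\in\mathbb{N}$ there exists $f^{(k)}\in Y^*$ with $e^{(k)}=A^*f^{(k)}$.
   Context: All spaces are real; $\mathbb{N}=\{1,2,\ldots\}$; $e^{(k)}$ is the unit sequence with $1$ at position $k$ and $0$ elsewhere. $Y^*$ is identified with $L^2(0,1)$, and $[A^*f]_k=\langle f,Ae^{(k)}\rangle_{L^2(0,1)}$. Haar system $\{u^{(k)}\}_{k\in\mathbb{N}}$ in $L^2(0,1)$: $u^{(1)}(s)=1$ for $s\in(0,1)$, and $u^{(1+2^l+k)}(s)=\psi_{l,k}(s)=2^{l/2}\psi(2^ls-k)$ for $s\in(0,1)$, $l=0,1,2,\ldots$, $k=0,1,\ldots,2^l-1$, where $\psi(s)=1$ on $(0,\frac12)$, $\psi(s)=-1$ on $(\frac12,1)$, and $\psi=0$ outside $(0,1)$. The synthesis operator is $Lx=\sum_{k=1}^\infty x_ku^{(k)}$. *)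

(* Defs.v *)
From HB Require Import structures.
From mathcomp Require Import all_boot all_order all_algebra.
From mathcomp Require Import all_classical all_reals all_analysis.
From mathcomp Require Import ess_sup_inf measurable_realfun.

Set Implicit Arguments.
Unset Strict Implicit.
Unset Printing Implicit Defensive.
Import Order.TTheory GRing.Theory Num.Theory.
Import numFieldNormedType.Exports.

Local Open Scope classical_set_scope.
Local Open Scope ring_scope.

(* Function spaces are represented by the library type LfunType of measurable
   functions with finite norm, i.e. without passing to almost-everywhere
   classes.  Everything below depends only on the classes, up to a.e. equality.
   Sequences over {1, 2, 3, ...} are indexed from 0: index k : nat stands for
   position k + 1. *)

Lemma lebesgue_unit_itv_lty (R : realType) :
  (@lebesgue_measure R `]0%R, 1%R[%classic < +oo)%E.
Proof. by rewrite lebesgue_measure_itv /= lte_fin ltr01 -EFinD ltry. Qed.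

(* Lebesgue measure on (0, 1), as a measure on the real line that does not
   charge the complement of (0, 1). *)
Definition mu01 (R : realType) :
    {finite_measure set (measurableTypeR R) -> \bar R} :=
  @mfrestr _ (measurableTypeR R) R _ (@lebesgue_measure R)
    (measurable_itv `]0%R, 1%R[) (lebesgue_unit_itv_lty R).

Definition L2 (R : realType) := LfunType (mu01 R) (lee1n 2).

(* The only null set of the counting measure is empty, so that here functions
   and classes coincide. *)
Definition ell (R : realType) (p : \bar R) (p1 : (1 <= p)%E) :=
  LfunType (@counting nat R) p1.
Definition ell1 (R : realType) := ell (lexx (1%E : \bar R)).
Definition ell2 (R : realType) := ell (lee1n 2 : (1 <= 2%:R%:E :> \bar R)%E).
Definition ellinfty (R : realType) := ell (leey (1%E : \bar R)).

Section spaces.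
Context {R : realType}.
Notation mu := (mu01 R).

Lemma bounded_Lfun (p : \bar R) (f : R -> R) (M : R) : (1 <= p)%E ->
  measurable_fun [set: measurableTypeR R] f ->
  (forall s, `|f s| <= M) -> f \in Lfun mu p.
Proof.
move=> p1 mf fM.
apply: (@Lfun_subset _ _ _ _ p +oo%E) => //; first by rewrite leey.
- exact: fin_num_measure.
- by rewrite leey.
- rewrite inE; apply/andP; split; rewrite inE//=.
  rewrite /finite_norm unlock; case: ifPn => // _.
  apply: (@le_lt_trans _ _ M%:E); last exact: ltry.
  by apply/ess_supP/nearW => s /=; rewrite lee_fin.
Qed.

Lemma L2_integrable (f : L2 R) : mu.-integrable [set: R] (EFin \o f).
Proof.
apply/Lfun1_integrable; apply: Lfun_subset12; last exact: LfunP.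
exact: fin_num_measure.
Qed.

Lemma seq_Lfun (p : \bar R) (x : nat -> R) :
  ('N[@counting nat R]_p [EFin \o x] < +oo)%E -> x \in Lfun (@counting nat R) p.
Proof. by move=> xfin; rewrite inE; apply/andP; split; rewrite inE. Qed.

Lemma ellinfty_subproof (x : nat -> R) (M : R) :
  (forall k, `|x k| <= M) -> x \in Lfun (@counting nat R) +oo%E.
Proof.
move=> xM; apply: seq_Lfun; rewrite unlock; case: ifPn => // _.
apply: (@le_lt_trans _ _ M%:E); last exact: ltry.
by apply/ess_supP/nearW => s /=; rewrite lee_fin.
Qed.

Lemma unit_seq_subproof (p : \bar R) (k : nat) : (1 <= p)%E ->
  (fun j => (j == k)%:R : R) \in Lfun (@counting nat R) p.
Proof.
case: p => [r r1| _|//]; last first.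
  by apply: (@ellinfty_subproof _ 1) => j; case: (j == k); rewrite ?normr1 ?normr0.
have r0 : 0 < r by rewrite (lt_le_trans ltr01).
apply: seq_Lfun; rewrite Lnorm_counting//; apply: poweR_lty.
rewrite (@nneseries_split _ _ 0 k.+1); last first.
  by move=> j _; exact: poweR_ge0.
rewrite eseries0 ?adde0; last first.
  move=> j; rewrite add0n => kj _ /=.
  by rewrite gtn_eqF// normr0 powR0// gt_eqF.
rewrite ltey_eq; apply/orP; left.
by apply/sum_fin_numP => j _ _ /=.
Qed.

Definition unit_seq {p : \bar R} {p1 : (1 <= p)%E} (k : nat) : ell p1 :=
  Lfun_Sub p1 (unit_seq_subproof k p1).

Lemma ell12_subproof (x : ell1 R) :
  (x : nat -> R) \in Lfun (@counting nat R) 2%:R%:E.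
Proof.
apply: seq_Lfun; rewrite Lnorm_counting//; apply: poweR_lty.
have : ('N[@counting nat R]_1%:E [EFin \o x] < +oo)%E by exact: Lfunction_finite.
rewrite Lnorm_counting// invr1 poweRe1; last first.
  by apply: nneseries_ge0 => k _ _; exact: poweR_ge0.
under eq_eseriesr do rewrite poweRe1//.
set S := (\sum_(_ <= _ <oo) _)%E => Sfin.
have S0 : (0 <= S)%E by apply: nneseries_ge0.
have Sf : S \is a fin_num by rewrite ge0_fin_numE.
have xS k : (`|(EFin \o x) k| <= S)%E.
  apply: le_trans (nneseries_lim_ge (m := 0) k.+1 _) => //.
  by rewrite big_nat_recr//= leeDr// sume_ge0.
apply: (@le_lt_trans _ _ (\sum_(0 <= k <oo) S * `|(EFin \o x) k|)%E).
  apply: lee_nneseries => k _ /=; first by rewrite lee_fin powR_ge0.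
  rewrite -(fineK Sf) -EFinM lee_fin powR_mulrn// expr2 ler_wpM2r//.
  by rewrite -lee_fin fineK//; exact: xS.
by rewrite -(fineK Sf) nneseriesZl// ?lte_mul_pinfty// lee_fin fine_ge0.
Qed.

(* The inclusion of l^1 into l^2 *)
Definition ell12 (x : ell1 R) : ell2 R := Lfun_Sub (lee1n 2) (ell12_subproof x).


Definition primitive_fun (x : R -> R) (s : R) : R :=
  \int[mu]_(t in `]0, s[) x t.

Lemma primitive_bound (x : L2 R) (s : R) :
  `|primitive_fun x s| <= \int[mu]_t `|x t|.
Proof.
have ix := L2_integrable x.
have mI : measurable (`]0, s[%classic : set (measurableTypeR R)).
  exact: measurable_itv.
have ixs : mu.-integrable `]0, s[ (EFin \o x) by apply: integrableS ix.
rewrite /primitive_fun; apply: (le_trans (le_normr_Rintegral _ _)) => //.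
apply: fine_le.
- by apply: integrable_fin_num => //; exact: integrable_abse ixs.
- by apply: integrable_fin_num => //; exact: integrable_abse ix.
- apply: ge0_subset_integral => //.
  by apply/measurable_EFinP; exact: measurableT_comp.
Qed.

Lemma measurable_primitive (x : L2 R) :
  measurable_fun [set: measurableTypeR R] (primitive_fun x).
Proof.
have ix := L2_integrable x.
have iax : mu.-integrable [set: R] (EFin \o (fun t => `|x t|)).
  exact: integrable_abse ix.
have mI s : measurable (`]0, s[%classic : set (measurableTypeR R)).
  exact: measurable_itv.
have mono (g : R -> R) : (forall t, 0 <= g t) -> mu.-integrable [set: R] (EFin \o g) ->
    measurable_fun [set: measurableTypeR R] (primitive_fun g).
  move=> g0 ig; apply: nondecreasing_measurable => // s t st.
  apply: fine_le.
  - by apply: integrable_fin_num => //; apply: integrableS ig.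
  - by apply: integrable_fin_num => //; apply: integrableS ig.
  - apply: ge0_subset_integral => //.
    + by apply: measurable_funTS; case/integrableP : ig.
    + by move=> r _; rewrite lee_fin.
    + by apply: subset_itvl; rewrite bnd_simp.
rewrite (_ : primitive_fun x = fun s =>
    primitive_fun (fun t => x t + `|x t|) s - primitive_fun (fun t => `|x t|) s).
  apply: measurable_funB.
  - apply: mono; last by apply: (integrableD _ ix iax).
    by move=> t; rewrite -lerBlDl sub0r -normrN ler_norm.
  - by apply: mono => //.
apply/funext => s; rewrite /primitive_fun RintegralD//; last 2 first.
- by apply: integrableS ix.
- by apply: integrableS iax.
by rewrite addrK.
Qed.

Lemma primitive_subproof (x : L2 R) : primitive_fun x \in Lfun mu 2%:R%:E.
Proof.
apply: (@bounded_Lfun _ _ (\int[mu]_t `|x t|)) => //; first exact: lee1n.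
- exact: measurable_primitive.
- exact: primitive_bound.
Qed.

Definition primitive (x : L2 R) : L2 R :=
  Lfun_Sub (lee1n 2) (primitive_subproof x).

(* The value at 1/2, immaterial in L^2, is 0. *)
Definition haar_mother (s : R) : R :=
  \1_`]0, 2^-1[%classic s - \1_`]2^-1, 1[%classic s.

Definition haar_wavelet (l k : nat) (s : R) : R :=
  2 `^ (l%:R / 2) * haar_mother (2 ^+ l * s - k%:R).

(* n = 0 is the constant function; every n > 0 is uniquely 2 ^ l + k with
   k < 2 ^ l, where l = trunc_log 2 n, see haar_funE. *)
Definition haar_fun (n : nat) (s : R) : R :=
  if n is 0%N then 1
  else haar_wavelet (trunc_log 2 n) (n - 2 ^ trunc_log 2 n)%N s.

Lemma haar_funE (l k : nat) (s : R) : (k < 2 ^ l)%N ->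
  haar_fun (2 ^ l + k)%N s = haar_wavelet l k s.
Proof.
move=> kl; have lE : trunc_log 2 (2 ^ l + k) = l.
  by apply: trunc_log_eq => //; rewrite leq_addr expnS mul2n -addnn ltn_add2l.
rewrite /haar_fun; case E : (2 ^ l + k)%N => [|n].
  by move/eqP: E; rewrite addn_eq0 expn_eq0.
by rewrite -E lE addKn.
Qed.

Lemma haar_mother_le (s : R) : `|haar_mother s| <= \1_`]0, 1[%classic s.
Proof.
rewrite /haar_mother !indicE !mem_setE !in_itv/=.
case: (ltP 0 s) => s0 /=; last first.
  rewrite [2^-1 < s]ltNge (le_trans s0) ?invr_ge0//= subrr normr0//.
have h1 : 2^-1 < 1 :> R by rewrite invf_lt1// ltr1n.
have [s2|s2] := ltP s 2^-1.
  by rewrite (lt_trans s2 h1) ltNge (ltW s2) /= subr0 normr1.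
rewrite sub0r normrN; case: (ltP s 1) => s1; rewrite ?andbF ?normr0//.
by case: (_ < _); rewrite /= ?normr1 ?normr0 ?ler01.
Qed.

Lemma measurable_haar_fun (n : nat) :
  measurable_fun [set: measurableTypeR R] (haar_fun n).
Proof.
case: n => [|n]; first exact: measurable_cst.
rewrite /haar_fun /haar_wavelet; apply: measurable_funM => //.
apply: (@measurableT_comp _ _ _ _ _ _ haar_mother).
- by apply: measurable_funB; apply: measurable_indic; exact: measurable_itv.
- by apply: measurable_funB => //; apply: measurable_funM.
Qed.

Lemma haar_fun_bounded (n : nat) : exists M, forall s, `|haar_fun n s| <= M.
Proof.
case: n => [|n]; first by exists 1 => s; rewrite /= normr1.
set l := trunc_log 2 n.+1; exists (2 `^ (l%:R / 2)) => s.
rewrite /haar_fun /haar_wavelet normrM (ger0_norm (powR_ge0 _ _)).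
rewrite ler_piMr ?powR_ge0// (le_trans (haar_mother_le _))//.
Qed.

Lemma haar_subproof (n : nat) : haar_fun n \in Lfun mu 2%:R%:E.
Proof.
have [M hM] := haar_fun_bounded n.
by apply: (bounded_Lfun _ _ hM); [exact: lee1n|exact: measurable_haar_fun].
Qed.

Definition haar (n : nat) : L2 R := Lfun_Sub (lee1n 2) (haar_subproof n).

Definition is_haar_sum (x : ell2 R) (g : L2 R) :=
  ('N[mu]_2%:R%:E[EFin \o (g - \sum_(k < n) x k *: haar k)%R])%E @[n --> \oo]
    --> 0%E.

(* The sum of the series in L^2, which exists for every x in l^2 because the
   Haar system is orthonormal and L^2 is complete, and is unique up to a.e.
   equality; the default value 0 of xget is thus never used. *)
Definition synthesis (x : ell2 R) : L2 R := xget 0 [set g | is_haar_sum x g].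

(* The composition of integration and synthesis, restricted to l^1 *)
Definition opA (x : ell1 R) : L2 R := primitive (synthesis (ell12 x)).

Definition L2_inner (f g : L2 R) : R :=
  \int[mu]_s (f s * g s).


Lemma haar_partial_sum_unit (k n : nat) : (k < n)%N ->
  \sum_(j < n) ell12 (unit_seq k) j *: haar j = haar k.
Proof.
move=> kn; rewrite (bigD1 (Ordinal kn))//= eqxx scale1r big1 ?addr0// => j jk.
suff -> : (nat_of_ord j == k) = false by rewrite scale0r.
by apply: contraNF jk => /eqP jk; exact/eqP/val_inj.
Qed.

Lemma is_haar_sum_unit_uniq (k : nat) (g : L2 R) :
  is_haar_sum (ell12 (unit_seq k)) g -> g = haar k %[ae mu].
Proof.
move=> gk.
have N0 : ('N[mu]_2%:R%:E[EFin \o (g - haar k)%R])%E = 0%E.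
  apply/esym; apply: cvg_unique gk _ => //; apply: cvg_near_cst.
  by near=> n; rewrite haar_partial_sum_unit//; near: n; exists k.+1.
have : (EFin \o (g - haar k)%R) = \0%E %[ae mu].
  by apply: Lnorm_eq0_eq0 N0 => //; exact/measurable_EFinP.
apply: filterS => s /(_ I) /= [] /eqP; rewrite subr_eq0 => /eqP gh _.
exact: gh.
Unshelve. all: by end_near. Qed.

Lemma synthesis_unit (k : nat) :
  synthesis (ell12 (unit_seq k)) = haar k %[ae mu].
Proof.
apply: is_haar_sum_unit_uniq; apply: (@xgetPex _ 0 [set g | is_haar_sum _ g]).
exists (haar k) => /=.
apply: cvg_near_cst; near=> n; rewrite haar_partial_sum_unit; last first.
  by near: n; exists k.+1.
by rewrite subrr; apply: Lnorm0; rewrite eqe pnatr_eq0.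
Unshelve. all: by end_near. Qed.

Lemma haar_L1_le1 (k : nat) : \int[mu]_s `|haar k s| <= 1.
Proof.
have mabs : measurable_fun [set: measurableTypeR R] (fun s => `|haar k s|%:E).
  by apply/measurable_EFinP; exact: measurableT_comp.
suff : (\int[mu]_s `|haar k s|%:E <= 1)%E.
  move=> le1; rewrite -lee_fin fineK//.
  by rewrite ge0_fin_numE ?integral_ge0// (le_lt_trans le1)// ltry.
have muE (A : set (measurableTypeR R)) :
  (mu : {measure set (measurableTypeR R) -> \bar R}) A =
  lebesgue_measure (A `&` `]0%R, 1%R[%classic) by [].
case: k mabs => [|n] mabs.
  under eq_integral do rewrite /= normr1.
  rewrite integral_cst// mul1e muE setTI lebesgue_measure_itv/= lte_fin ltr01.
  by rewrite sube0.
set l := trunc_log 2 n.+1; set m := (n.+1 - 2 ^ l)%N.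
set c : R := 2 `^ (l%:R / 2).
set q : R := 2 ^+ l; have q0 : 0 < q by rewrite exprn_gt0.
pose I : set R := `]m%:R / q, (m%:R + 1) / q[%classic.
have mI : measurable (I : set (measurableTypeR R)) by exact: measurable_itv.
apply: (@le_trans _ _ (\int[mu]_s (c * \1_I s)%:E)%E).
  apply: ge0_le_integral => //.
  - by apply/measurable_EFinP; apply: measurable_funM => //; exact: measurable_indic.
  - move=> s _; rewrite lee_fin /= /haar_wavelet -/l -/m -/c normrM.
    rewrite ger0_norm ?powR_ge0// ler_wpM2l ?powR_ge0//.
    apply: (le_trans (haar_mother_le _)); rewrite !indicE !mem_setE !in_itv/=.
    by rewrite subr_gt0 ltrBlDl ltr_pdivrMr// ltr_pdivlMr// (mulrC s) addrC.
under eq_integral do rewrite EFinM.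
rewrite ge0_integralZl//; last 2 first.
  - by apply/measurable_EFinP; exact: measurable_indic.
  - by rewrite lee_fin powR_ge0.
rewrite integral_indic// setIT.
apply: (@le_trans _ _ (c%:E * (q^-1)%:E)%E).
  apply: lee_wpmul2l; first by rewrite lee_fin powR_ge0.
  rewrite muE; apply: (@le_trans _ _ (@lebesgue_measure R I)).
    by apply: le_measure; rewrite ?inE//; apply: measurableI.
  rewrite lebesgue_measure_itv/= lte_fin ltr_pM2r ?invr_gt0// ltrDl ltr01.
  by rewrite -EFinD -mulrBl addrAC subrr add0r mul1r.
rewrite -EFinM lee_fin ler_pdivrMr// mul1r /c /q -powR_mulrn//.
by rewrite ler_powR ?ler1n// ler_pdivrMr// ler_peMr// ler1n.
Qed.

Lemma L2_inner_opA_bound (f : L2 R) (k : nat) :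
  `|L2_inner f (opA (unit_seq k))| <= \int[mu]_s `|f s|.
Proof.
set g := opA _; have g1 s : `|g s| <= 1.
  apply: (le_trans (primitive_bound _ s)); apply: le_trans (haar_L1_le1 k).
  rewrite le_eqVlt; apply/orP; left; apply/eqP; congr fine.
  apply: ae_eq_integral => //; try exact/measurable_EFinP/measurableT_comp.
  by apply: filterS (synthesis_unit k) => s' + _ => /(_ I) /= ->.
have ifg : mu.-integrable [set: R] (EFin \o (fun s => f s * g s)).
  by apply/Lfun1_integrable; apply: Lfun2_mul_Lfun1; exact: LfunP.
apply: (le_trans (le_normr_Rintegral _ _)) => //.
apply: le_Rintegral => //; first exact: integrable_abse ifg.
- exact: integrable_abse (L2_integrable f).
- by move=> s _; rewrite normrM ler_piMr.
Qed.

Lemma adjoint_subproof (f : L2 R) :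
  (fun k => L2_inner f (opA (unit_seq k)))
    \in Lfun (@counting nat R) +oo%E.
Proof. exact: ellinfty_subproof (L2_inner_opA_bound f). Qed.

(* The adjoint of opA, with the dual of L^2 identified with L^2 and the dual of
   l^1 with l^oo: its k-th coordinate at f is the pairing of f with the image
   under opA of the k-th unit sequence. *)
Definition adjointA (f : L2 R) : ellinfty R :=
  Lfun_Sub (leey 1%E) (adjoint_subproof f).

End spaces.

(* Main.v *)
(* Let c_n = 2^n 1_(1 - 2^-n, 1).  Almost everywhere, c_n - c_(n+1) is a
   multiple of a Haar function of level n, and c_0 is the constant Haar function.
   If A* f = e^(1), then f is orthogonal to the primitives of all nonconstant
   Haar functions, so <f, primitive of c_n> = <f, primitive of c_0> = 1 for all
   n.  But these primitives are bounded by 1 and tend to 0 pointwise on (0, 1),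
   hence 1 = 0 by dominated convergence. *)

Require Import Defs.
From mathcomp Require Import all_boot all_order all_algebra.
From mathcomp Require Import all_classical all_reals all_analysis.
From mathcomp Require Import measurable_realfun ring lra.

Set Implicit Arguments.
Unset Strict Implicit.
Unset Printing Implicit Defensive.
Import Order.TTheory GRing.Theory Num.Theory.
Import numFieldNormedType.Exports.

Local Open Scope classical_set_scope.
Local Open Scope ring_scope.

Lemma mu01E (R : realType) (A : set (measurableTypeR R)) :
  (mu01 R : {measure set (measurableTypeR R) -> \bar R}) A =
  lebesgue_measure (A `&` `]0%R, 1%R[%classic).
Proof. by []. Qed.

(** The elements of [L2 R] are functions on the whole line; this allows their values outside (0, 1)
    to be ignored. *)
Lemma mu01_ae_unit_itv (R : realType) :
  \forall s \ae mu01 R, (s : R) \in `]0, 1[.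
Proof.
exists (~` `]0%R, 1%R[%classic); split.
- by apply: measurableC; exact: measurable_itv.
- by apply: (etrans (mu01E _)); rewrite setICl measure0.
- by move=> s /=; apply: contra_not => ->.
Qed.

Lemma mu01_ae_neq (R : realType) (a : R) : \forall s \ae mu01 R, (s : R) != a.
Proof.
exists [set a]; split => //.
- apply/eqP; rewrite -measure_le0 [leLHS]mu01E -(lebesgue_measure_set1 a).
  apply: le_measure; rewrite ?inE//; apply: measurableI => //; exact: measurable_itv.
- by move=> s /= /negP; rewrite negbK => /eqP.
Qed.

Section primitive_pairing.
Context {R : realType}.
Notation mu := (mu01 R).
Implicit Types f x y z : L2 R.

(** Integrals ignore null sets, so a.e. equality upgrades to equality at every point. This matters
    because [synthesis] is pinned down only up to a.e. equality. *)
Lemma eq_ae_primitive_fun x y : x = y %[ae mu] ->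
  primitive_fun x = primitive_fun y.
Proof.
move=> xy; apply/funext => s; congr fine; apply: ae_eq_integral.
- exact: measurable_itv.
- exact/measurable_funTS/measurable_EFinP.
- exact/measurable_funTS/measurable_EFinP.
- by apply: filterS xy => t + _ => /(_ I) /= ->.
Qed.

Lemma opA_unit_seq (k : nat) :
  (opA (unit_seq k) : R -> R) = primitive_fun (haar k).
Proof. exact: eq_ae_primitive_fun (synthesis_unit k). Qed.

Lemma L2_inner_integrable f x : mu.-integrable setT (EFin \o (fun s => f s * x s)).
Proof. by apply/Lfun1_integrable; apply: Lfun2_mul_Lfun1; exact: LfunP. Qed.

(** Both integration and the pairing are linear. The relation is assumed only a.e., since the
    identity between bumps and Haar functions fails at a midpoint. *)
Lemma L2_inner_primitiveDZ f x y z (a : R) :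
  (\forall s \ae mu01 R, x s = y s + a * z s) ->
  L2_inner f (primitive x) =
  L2_inner f (primitive y) + a * L2_inner f (primitive z).
Proof.
move=> xyz.
have -> : L2_inner f (primitive x) =
    L2_inner f (primitive y + a *: primitive z).
  congr (Rintegral _ _ _); apply/funext => s; congr (_ * _).
  rewrite /= (@eq_ae_primitive_fun x (y + a *: z)); last first.
    by apply: filterS xyz => t ->.
  have mI : measurable (`]0, s[%classic : set (measurableTypeR R)).
    exact: measurable_itv.
  have iy := integrableS measurableT mI (@subsetT _ _) (L2_integrable y).
  have iz := integrableS measurableT mI (@subsetT _ _) (L2_integrable z).
  rewrite /primitive_fun -[LHS]/(\int[mu]_(t in `]0, s[) (y t + a * z t)).
  by rewrite RintegralD// ?RintegralZl//; exact: (integrableZl mI a iz).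
rewrite /L2_inner -RintegralZl//; last exact: L2_inner_integrable.
rewrite -RintegralD//; last 2 first.
- exact: L2_inner_integrable.
- exact: (integrableZl measurableT a (L2_inner_integrable f (primitive z))).
by apply: eq_Rintegral => s _ /=; rewrite mulrDr mulrCA.
Qed.

End primitive_pairing.

Section bump.
Context {R : realType}.
Notation mu := (mu01 R).

Definition bump_fun (n : nat) (s : R) : R :=
  2 ^+ n * \1_`]1 - (2 ^+ n)^-1, 1[%classic s.

Lemma bump_subproof (n : nat) : bump_fun n \in Lfun mu 2%:R%:E.
Proof.
apply: (@bounded_Lfun _ _ _ (2 ^+ n)); first exact: lee1n.
- apply: measurable_funM => //; apply: measurable_indic; exact: measurable_itv.
- move=> s; rewrite normrM ger0_norm ?exprn_ge0// ler_piMr ?exprn_ge0//.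
  by rewrite indicE; case: (_ \in _); rewrite ?normr1 ?normr0.
Qed.

Definition bump (n : nat) : L2 R := Lfun_Sub (lee1n 2) (bump_subproof n).

(** The height 2^n offsets the length 2^-n of the support. The resulting bound on the primitives is
    uniform in n, as dominated convergence requires. *)
Lemma bump_L1_le1 (n : nat) : \int[mu]_s `|bump n s| <= 1.
Proof.
have q0 : 0 < 2 ^+ n :> R by rewrite exprn_gt0.
have mI : measurable (`]1 - (2 ^+ n)^-1, 1[%classic : set (measurableTypeR R)).
  exact: measurable_itv.
rewrite (@eq_Rintegral _ _ _ _ _ (bump n)); last first.
  by move=> s _; rewrite ger0_norm//= /bump_fun mulr_ge0// ?exprn_ge0.
suff : (\int[mu]_s (bump n s)%:E <= 1)%E.
  move=> le1; rewrite -lee_fin fineK//.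
  by apply: integrable_fin_num => //; exact: L2_integrable.
rewrite /= /bump_fun; under eq_integral do rewrite EFinM.
rewrite ge0_integralZl//; last first.
  by apply/measurable_EFinP; exact: measurable_indic.
rewrite integral_indic// setIT.
apply: (@le_trans _ _ ((2 ^+ n)%:E * ((2 ^+ n)^-1)%:E)%E); last first.
  by rewrite -EFinM divff// gt_eqF.
apply: lee_wpmul2l; first by rewrite lee_fin exprn_ge0.
apply: (@le_trans _ _ (@lebesgue_measure R `]1 - (2 ^+ n)^-1, 1[%classic)).
  by rewrite [leLHS]mu01E; apply: le_measure; rewrite ?inE//; exact: measurableI.
rewrite lebesgue_measure_itv/= lte_fin ltrBlDr ltrDl invr_gt0 q0 -EFinD.
by rewrite opprB addrC subrK.
Qed.

Lemma primitive_bump_le1 (n : nat) (s : R) : `|primitive (bump n) s| <= 1.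
Proof. exact: le_trans (primitive_bound _ _) (bump_L1_le1 n). Qed.

Lemma primitive_bump_eq0 (n : nat) (s : R) :
  s <= 1 - (2 ^+ n)^-1 -> primitive (bump n) s = 0.
Proof.
move=> sn; rewrite /= /primitive_fun (@eq_Rintegral _ _ _ _ _ (cst 0)).
  by rewrite /Rintegral integral0.
move=> t; rewrite inE/= in_itv/= => /andP[_ ts].
rewrite /bump_fun indicE memNset ?mulr0//= in_itv/= => /andP[nt _].
by have := lt_le_trans (lt_trans nt ts) sn; rewrite ltxx.
Qed.

Lemma primitive_bump_cvg (s : R) : s < 1 ->
  primitive (bump n) s @[n --> \oo] --> (0 : R).
Proof.
move=> s1; apply: cvg_near_cst; near=> n.
apply: primitive_bump_eq0; rewrite lerBrDl -lerBrDr.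
rewrite invf_ple ?posrE ?exprn_gt0 ?subr_gt0//.
(* The primitive vanishes at s once 2^n >= 1 / (1 - s); since n < 2^n, any n above 1 / (1 - s) will
   do. *)
apply: (@le_trans _ _ n%:R); last by rewrite -natrX ler_nat ltnW// ltn_expl.
by apply: ltW; near: n; exact: nbhs_infty_gtr.
Unshelve. all: by end_near. Qed.

(* The Haar function is the last one of level n, supported on (1 - 2^-n, 1);
   at the midpoint of this interval the identity fails. *)
Lemma bump_haar (n : nat) : \forall s \ae mu01 R,
  bump n s = bump n.+1 s + 2 `^ (n%:R / 2) * haar (2 ^ n + (2 ^ n).-1) s.
Proof.
apply: (@filterS _ _ (ae_filter_ringOfSetsType _) _ _ _
  (mu01_ae_neq (1 - (2 ^+ n.+1)^-1))) => s.
have q0 : 0 < 2 ^+ n :> R by rewrite exprn_gt0.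
rewrite /= haar_funE ?prednK ?expn_gt0// /haar_wavelet mulrA.
(* The coefficient 2^(n/2) and the normalization 2^(n/2) of the wavelet multiply to 2^n. *)
rewrite -powRD; last by rewrite pnatr_eq0/= implybT.
rewrite -splitr powR_mulrn// -subn1 natrB ?expn_gt0// natrX /bump_fun /haar_mother exprS.
move: (2 ^+ n) q0 => q q0; rewrite invfM !indicE !mem_setE !in_itv/=.
(* This affine change of variable maps (1 - 2^-n, 1) onto (0, 1): all endpoints become 0, 1/2 or 1,
   and the excluded midpoint becomes t = 1/2. *)
set t := q * s - (q - 1).
have -> : s = 1 - q^-1 + q^-1 * t by rewrite /t; field; rewrite gt_eqF.
have cmp a b a' b' : b - a = q^-1 * (b' - a') -> (a < b) = (a' < b').
  by move=> ab; rewrite -subr_gt0 ab pmulr_rgt0 ?invr_gt0// subr_gt0.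
rewrite (cmp (1 - q^-1) _ 0 t); last by ring.
rewrite (cmp _ 1 t 1); last by ring.
rewrite (cmp (1 - 2^-1 * q^-1) _ 2^-1 t); last by field; rewrite gt_eqF.
rewrite -subr_eq0 (_ : _ - _ = q^-1 * (t - 2^-1)); last by field; rewrite gt_eqF.
rewrite mulf_eq0 invr_eq0 gt_eqF//= subr_eq0 neq_lt.
move: t => t ht.
have [t0|t0] := ltP 0 t; have [th|th] := ltP t 2^-1; have [t1|t1] := ltP t 1;
  have [tg|tg] := ltP 2^-1 t; rewrite /= ?(mulr0, mulr1, subr0, sub0r, addr0); lra.
Qed.

End bump.

Theorem proposition4p1 (R : realType) :
  ~ range (@adjointA R) (unit_seq 0 : ellinfty R) /\
  ~ (forall k : nat, exists f : L2 R, (unit_seq k : ellinfty R) = adjointA f).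
Proof.
suff not_range : ~ range (@adjointA R) (unit_seq 0 : ellinfty R).
  by split => // /(_ 0%N) [f fE]; apply: not_range; exists f.
case=> f _ fE.
have f_haar k : L2_inner f (primitive (haar k)) = (k == 0%N)%:R.
  have := congr1 (fun x : ellinfty R => x k) fE; rewrite /= => <-.
  by rewrite /L2_inner opA_unit_seq.
have f_bump n : L2_inner f (primitive (bump n)) = 1.
  elim: n => [|n <-]; last first.
    (* The Haar index 2^n + (2^n - 1) is positive, so the Haar term pairs to 0. *)
    rewrite (L2_inner_primitiveDZ _ (bump_haar n)) f_haar.
    by rewrite addn_eq0 expn_eq0/= mulr0 addr0.
  (* [bump 0] is the indicator of (0, 1) and [haar 0] is 1 on the whole line; they agree a.e. for
     [mu01]. *)
  rewrite -[1]/((0 == 0)%N%:R) -f_haar /L2_inner /=.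
  rewrite (@eq_ae_primitive_fun _ (bump 0) (haar 0))//.
  apply: (@filterS _ _ (ae_filter_ringOfSetsType _) _ _ _
    (mu01_ae_unit_itv R)) => s s01 _ /=.
  by rewrite /bump_fun expr0 invr1 subrr mul1r indicE mem_set.
pose g n (s : measurableTypeR R) : \bar R := (f s * primitive (bump n) s)%:E.
have mg n : measurable_fun setT (g n).
  by apply/measurable_EFinP; apply: measurable_funM.
have g_cvg : \forall s \ae mu01 R, setT s -> g n s @[n --> \oo] --> 0%E.
  apply: (@filterS _ _ (ae_filter_ringOfSetsType _) _ _ _
    (mu01_ae_unit_itv R)) => s; rewrite in_itv/= => /andP[_ s1] _.
  apply: cvg_EFin; first exact: nearW.
  by rewrite -[X in _ --> X](mulr0 (f s)); apply: cvgMl_tmp; exact: primitive_bump_cvg.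
(* The dominating function |f| is integrable because [mu01] is finite, so that L^2 lies in L^1. *)
have g_bound : \forall s \ae mu01 R, forall n, setT s -> (`|g n s| <= `|f s|%:E)%E.
  apply: aeW => s n _; rewrite /g /= lee_fin normrM ler_piMr//.
  exact: primitive_bump_le1.
have [_ _] := dominated_convergence measurableT mg (measurable_cst _) g_cvg
  (integrable_abse (L2_integrable f)) g_bound.
have -> : (fun n => \int[mu01 R]_s g n s)%E = cst 1%E.
  apply/funext => n; rewrite -[RHS]/(1%:E) -(f_bump n) /L2_inner fineK//.
  by apply: integrable_fin_num => //; exact: L2_inner_integrable.
rewrite integral0 => /(cvg_unique (@ereal_hausdorff R) (cvg_cst _)) /eqP.
by rewrite eqe oner_eq0.
Qed.
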